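(* Let $\mathbb P$ be a concept class of generalized propensity scores and $\mathbb D$ a concept class of covariate-outcome distributions. The average treatment effect $\tau_{\mathcal D}$ is identifiable from the censored distribution $\mathcal C_{\mathcal D}$ over the family of all observational studies $\mathcal D$ realizable with respect to $(\mathbb P,\mathbb D)$ if and only if $(\mathbb P,\mathbb D)$ satisfies the Identifiability Condition.
   Context: An observational study is a probability distribution $\mathcal D$ of a random tuple $(X,T,Y(0),Y(1))$ with covariates $X\in\mathbb R^d$, treatment $T\in\{0,1\}$ and potential outcomes $Y(0),Y(1)\in\mathbb R$; the joint laws $\mathcal D_{X,Y(t)}$ of $(X,Y(t))$, $t\in\{0,1\}$, are assumed to have densities, and $\mathcal D_X$ denotes the law of $X$. The censored distribution $\mathcal C_{\mathcal D}$ is the law of $(X,T,Y(T))$. The generalized propensity scores of $\mathcal D$ are $p_t(x,y)=\Pr_{\mathcal D}[T=t\mid X=x,Y(t)=y]$, $t\in\{0,1\}$. The average treatment effect is $\tau_{\mathcal D}=\mathbb E_{\mathcal D}[Y(1)-Y(0)]$. A concept class of generalized propensity scores is a set $\mathbb P$ of functions $\mathbb R^d\times\mathbb R\to[0,1]$; a concept class of covariate-outcome distributions is a set $\mathbb D$ of probability distributions with densities on $\mathbb R^d\times\mathbb R$; for $\mathcal P\in\mathbb D$, $\mathcal P(x,y)$ denotes its density and $\mathcal P_X$ its marginal on $\mathbb R^d$. $\mathcal D$ is realizable with respect to $(\mathbb P,\mathbb D)$ if $p_0,p_1\in\mathbb P$ and $\mathcal D_{X,Y(0)},\mathcal D_{X,Y(1)}\in\mathbb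 D$. A tuple $(p,\mathcal P)\in\mathbb P\times\mathbb D$ is compatible with $(\mathbb P,\mathbb D)$ if there exist $(\hat p,\hat{\mathcal P})\in\mathbb P\times\mathbb D$ and a valid observational study whose $(p_0,p_1,\mathcal D_{X,Y(0)},\mathcal D_{X,Y(1)})$ equals $(p,\hat p,\mathcal P,\hat{\mathcal P})$ (equivalently, $(\hat p,p,\hat{\mathcal P},\mathcal P)$). A quantity $\eta_{\mathcal D}$ is identifiable from $\mathcal C_{\mathcal D}$ over a family of observational studies if there exists a map $f$ from probability distributions on $\mathbb R^d\times\{0,1\}\times\mathbb R$ to $\mathbb R$ with $f(\mathcal C_{\mathcal D})=\eta_{\mathcal D}$ for every $\mathcal D$ in the family. Identifiability Condition: $(\mathbb P,\mathbb D)$ satisfies it if for any two tuples $(p,\mathcal P),(q,\mathcal Q)\in\mathbb P\times\mathbb D$ that are compatible with $(\mathbb P,\mathbb D)$, at least one of the following holds: (1) $\mathbb E_{(x,y)\sim\mathcal P}[y]=\mathbb E_{(x,y)\sim\mathcal Q}[y]$; (2) $\mathcal P_X\neq\mathcal Q_X$; (3) there exists $(x,y)\in\mathrm{supp}(\mathcal P_X)\times\mathbb R$ with $p(x,y)\mathcal P(x,y)\neq q(x,y)\mathcal Q(x,y)$.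
   Formalization: Condition (3) is read up to null sets: pP ≠ qQ must hold on a positive-measure subset of supp(P_X)×R, since a difference at a single point depends on the chosen versions and makes the claim false; outcomes in the class are assumed to have finite mean, so that the ATE is a real number. *)

(* Defs.v *)
From HB Require Import structures.
From mathcomp Require Import all_boot all_order all_algebra.
From mathcomp Require Import all_classical all_reals all_analysis.

Set Implicit Arguments.
Unset Strict Implicit.
Unset Printing Implicit Defensive.

Import Order.TTheory GRing.Theory Num.Theory.
Import numFieldTopology.Exports numFieldNormedType.Exports.
Local Open Scope classical_set_scope.
Local Open Scope ring_scope.

Section ObservationalStudies.
Variables (R : realType) (d : nat).

Definition Cov := g_sigma_algebraType (@open ('rV[R]_d : topologicalType)).

(* Space of (X, T, Y(0), Y(1)); T = false encodes t = 0, T = true encodes t = 1. *)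
Definition Omega := (Cov * bool * R * R)%type.
Definition CovOut := (Cov * R)%type.
Definition Cens := (Cov * bool * R)%type.

Definition covX (w : Omega) : Cov := w.1.1.1.
Definition trt (w : Omega) : bool := w.1.1.2.
Definition Yof (t : bool) (w : Omega) : R := if t then w.2 else w.1.2.
Definition XY (t : bool) (w : Omega) : CovOut := (covX w, Yof t w).
Definition cens (w : Omega) : Cens := (covX w, trt w, Yof (trt w) w).

Definition Study := probability Omega R.
Definition Dist := probability CovOut R.

Definition leb_null (N : set CovOut) : Prop :=
  forall eps : R, 0 < eps ->
  exists (a b : nat -> 'rV[R]_d) (c e : nat -> R),
    (forall k, (forall i, a k ord0 i <= b k ord0 i) /\ c k <= e k) /\
    N `<=` \bigcup_k [set z : CovOut |
               (forall i, a k ord0 i <= (z.1 : 'rV[R]_d) ord0 i <= b k ord0 i)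
               /\ c k <= z.2 <= e k] /\
    (\sum_(0 <= k <oo) ((\prod_(i < d) (b k ord0 i - a k ord0 i))
                         * (e k - c k))%:E < eps%:E)%E.

(* P has a density w.r.t. Lebesgue measure on R^d x R (i.e. P << Lebesgue;
   by Radon-Nikodym this is equivalent to the existence of a density). *)
Definition has_density (P : Dist) : Prop :=
  forall N, measurable N -> leb_null N -> P N = 0%E.

Definition law_is (D : Study) (t : bool) (P : Dist) : Prop :=
  forall A : set CovOut, measurable A -> D (XY t @^-1` A) = P A.

(* p is (a version of) the generalized propensity score
   p_t(x,y) = Pr_D[T = t | X = x, Y(t) = y]. *)
Definition is_propensity (D : Study) (t : bool) (p : CovOut -> R) : Prop :=
  measurable_fun setT p /\
  forall A : set CovOut, measurable A ->
    D ([set w | trt w = t] `&` XY t @^-1` A) =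
    (\int[D]_(w in XY t @^-1` A) (p (XY t w))%:E)%E.

Definition study_has (D : Study) (p0 p1 : CovOut -> R) (P0 P1 : Dist) : Prop :=
  [/\ is_propensity D false p0, is_propensity D true p1,
      law_is D false P0 & law_is D true P1].

Definition propensity_class (Pc : set (CovOut -> R)) : Prop :=
  forall p, Pc p -> forall z, 0 <= p z <= 1.

(* Distributions with densities (and finite mean outcome, implicit in the
   paper since the ATE is a real number). *)
Definition outcome_class (Dc : set Dist) : Prop :=
  forall P, Dc P -> has_density P /\ P.-integrable setT (fun z : CovOut => (z.2)%:E).

Definition realizable (Pc : set (CovOut -> R)) (Dc : set Dist) (D : Study) : Prop :=
  exists p0 p1 P0 P1, [/\ Pc p0, Pc p1, Dc P0, Dc P1 & study_has D p0 p1 P0 P1].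

Definition censored (D : Study) : set Cens -> \bar R :=
  fun A => if pselect (measurable A) then D (cens @^-1` A) else 0%E.

Definition ATE (D : Study) : \bar R := (\int[D]_w (Yof true w - Yof false w)%:E)%E.

Definition ATE_identifiable (Pc : set (CovOut -> R)) (Dc : set Dist) : Prop :=
  exists f : (set Cens -> \bar R) -> R,
    forall D : Study, realizable Pc Dc D -> (f (censored D))%:E = ATE D.

Definition compatible (Pc : set (CovOut -> R)) (Dc : set Dist)
    (p : CovOut -> R) (P : Dist) : Prop :=
  Pc p /\ Dc P /\
  exists (ph : CovOut -> R) (Ph : Dist) (D : Study), Pc ph /\ Dc Ph /\
    (study_has D p ph P Ph \/ study_has D ph p Ph P).

Definition meanY (P : Dist) : \bar R := (\int[P]_z (z.2)%:E)%E.

Definition margX (P : Dist) (B : set Cov) : \bar R := P (B `*` setT).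

Definition suppX (P : Dist) : set Cov :=
  [set x : Cov | forall U : set 'rV[R]_d, open U -> U x -> (0 < margX P U)%E].

Definition identifiability_condition (Pc : set (CovOut -> R)) (Dc : set Dist) : Prop :=
  forall (p q : CovOut -> R) (P Q : Dist),
    compatible Pc Dc p P -> compatible Pc Dc q Q ->
    [\/ meanY P = meanY Q,
        (exists B : set Cov, measurable B /\ margX P B <> margX Q B)
      | (exists A : set CovOut, [/\ measurable A, A `<=` suppX P `*` setT &
           (\int[P]_(z in A) (p z)%:E)%E <> (\int[Q]_(z in A) (q z)%:E)%E])].

End ObservationalStudies.

(* Main.v *)
(* Sufficiency: the censored law determines the law of X and, for each arm t,
   the measure A |-> D(T = t, (X, Y(t)) \in A) = \int_A p_t d(D_{X,Y(t)}); hence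
   two realizable studies with the same censored law fall in neither case (2)
   nor case (3), and their mean outcomes agree arm by arm.

   Necessity: let (p, P) and (q, Q) violate the condition, and let D1 be a study
   with (p_0, p_1, D_{X,Y(0)}, D_{X,Y(1)}) = (p, r, P, S) and D2 one for (q, Q).
   In D1, the outcome Y(0) of a treated unit is invisible to the censored law;
   redrawing it from the conditional law of Y(0) given X among the treated units
   of D2 gives a study (q, r, Q, S) with the same censored law as D1, but with
   average treatment effect E_S[y] - E_Q[y] instead of E_S[y] - E_P[y].  The
   treated units of D1 and D2 have the same law of X, since P_X = Q_X and
   p P = q Q.  No disintegration theorem is needed: a conditional quantile
   function built from Radon-Nikodym derivatives and an independent uniform
   variable do the resampling. *)

From HB Require Import structures.
Require Import Defs.
From mathcomp Require Import all_boot all_order all_algebra.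
From mathcomp Require Import all_classical all_reals all_analysis.
From mathcomp Require Import measurable_realfun.
Import Order.TTheory GRing.Theory Num.Theory.
Import numFieldTopology.Exports numFieldNormedType.Exports.
Set Implicit Arguments.
Unset Strict Implicit.
Unset Printing Implicit Defensive.
Local Open Scope classical_set_scope.
Local Open Scope ring_scope.

(** * Push-forwards, restrictions and comparison of measures *)

Lemma measure_pushforward d1 d2 (T : measurableType d1)
  (T' : measurableType d2) (R : realType)
  (mu : {measure set T -> \bar R}) (f : T -> T') :
  measurable_fun setT f ->
  exists nu : {measure set T' -> \bar R}, forall A, nu A = mu (f @^-1` A).
Proof.
move=> mf.
(* [pose] abstracts the measurability proof required by the canonical measure
   structure on [pushforward], so that [nu] is a function of that proof. *)
pose nu : {measure set T' -> \bar R} := pushforward mu f.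
by exists (nu mf).
Qed.

Lemma finite_measure_pushforward d1 d2 (T : measurableType d1)
  (T' : measurableType d2) (R : realType)
  (mu : {finite_measure set T -> \bar R}) (f : T -> T') :
  measurable_fun setT f ->
  exists nu : {finite_measure set T' -> \bar R},
    forall A, nu A = mu (f @^-1` A).
Proof.
move=> mf; have [nu nuE] := measure_pushforward mu mf.
have fin : (nu setT < +oo)%E.
  by rewrite nuE preimage_setT ltey_eq fin_num_measure.
(* Restriction to the whole space leaves [nu] unchanged but carries the finite-measure structure. *)
exists (mfrestr measurableT fin) => A.
by rewrite -nuE; congr (nu _); exact: setIT.
Qed.

Lemma probability_pushforward d1 d2 (T : measurableType d1)
  (T' : measurableType d2) (R : realType) (P : probability T R) (f : T -> T') :
  measurable_fun setT f ->
  exists Q : probability T' R, forall A, Q A = P (f @^-1` A).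
Proof.
move=> mf.
pose F : {mfun T >-> T'} := HB.pack f (isMeasurableFun.Build _ _ _ _ _ mf).
by exists (distribution P F).
Qed.

Lemma finite_measure_restr d (T : measurableType d) (R : realType)
  (mu : {finite_measure set T -> \bar R}) (D : set T) :
  measurable D ->
  exists nu : {finite_measure set T -> \bar R}, forall A, nu A = mu (A `&` D).
Proof.
move=> mD; have Dfin : (mu D < +oo)%E by rewrite ltey_eq fin_num_measure.
by exists (mfrestr mD Dfin).
Qed.

(** On the set where [g < f], the difference [f - g] is positive with integral at most 0, so it
    vanishes almost everywhere there; as it vanishes nowhere there, the set is null. *)
Lemma lt_set_null d (T : measurableType d) (R : realType)
  (mu : {measure set T -> \bar R}) (f g : T -> \bar R) :
  (forall x, f x \is a fin_num) -> (forall x, g x \is a fin_num) ->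
  mu.-integrable setT f -> mu.-integrable setT g ->
  (forall A, measurable A ->
    \int[mu]_(x in A) f x <= \int[mu]_(x in A) g x)%E ->
  mu [set x | (g x < f x)%E] = 0%E.
Proof.
move=> ffin gfin intf intg fg.
have mf := measurable_int _ intf; have mg := measurable_int _ intg.
set B := [set x | _].
have mB : measurable B.
  by rewrite -[B]setTI; exact: measurable_lte.
have intfB := integrableS measurableT mB (@subsetT _ _) intf.
have intgB := integrableS measurableT mB (@subsetT _ _) intg.
have fgB0 x : B x -> (0 <= (f \- g) x)%E.
  by move=> /ltW; rewrite sube_ge0// gfin.
have mfg : measurable_fun B (f \- g)%E.
  by apply: emeasurable_funB; exact: measurable_funTS.
have int0 : (\int[mu]_(x in B) `|(f \- g) x| = 0)%E.
  apply/eqP; rewrite eq_le integral_ge0// andbT.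
  rewrite (eq_integral (f \- g)%E); last first.
    by move=> x /set_mem Bx; rewrite gee0_abs// fgB0.
  rewrite integralB// sube_le0; exact: fg.
have /(_ int0) [N [mN N0 BN]] := (ae_eq_integral_abs mu mB mfg).1.
apply: (subset_measure0 mB mN _ N0).
move=> x Bx; apply: BN => /(_ Bx) /= /eqP.
rewrite sube_eq ?fin_num_adde_defl// add0e => /eqP E.
by move: Bx; rewrite /B /= E ltxx.
Qed.

(** * Conditional quantiles *)

Lemma uniform_prob_le (R : realType) (a : R) : 0 <= a <= 1 ->
  uniform_prob (@ltr01 R) [set u | u <= a] = a%:E.
Proof.
move=> /andP[a0 a1]; rewrite /uniform_prob integral_uniform_pdf.
have -> : [set u | u <= a] `&` `[0, 1]%classic = `[0, a]%classic :> set R.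
  apply/seteqP; split=> u /=; rewrite !in_itv/=.
    by move=> [-> /andP[->]].
  by move=> /andP[-> ua]; rewrite ua (le_trans ua).
rewrite (eq_integral (cst 1%E)); last first.
  move=> u; rewrite inE/= in_itv/= /uniform_pdf => /andP[-> ua].
  by rewrite (le_trans ua)// subr0 invr1.
rewrite integral_cst//= mul1e lebesgue_measure_itv/= lte_fin.
by case: ltgtP a0 => // [_ _|<- _]; rewrite ?sube0.
Qed.

(** [G r] is a version of the conditional distribution function at the rational [r]: the
    Radon-Nikodym derivative with respect to [m] of the measure [B |-> al (B x ]-oo, r])], which is
    dominated by [m] because it is at most [m]. Derivatives are unique only up to null sets, so
    monotonicity in [r] is obtained almost everywhere, one pair of rationals at a time. *)
Lemma conditional_cdf d (X : measurableType d) (R : realType)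
  (al : {finite_measure set (X * R)%type -> \bar R})
  (m : {finite_measure set X -> \bar R}) :
  (forall B, measurable B -> m B = al (B `*` setT)) ->
  exists G : rat -> X -> R,
    [/\ forall r, measurable_fun setT (G r),
        forall r x, 0 <= G r x <= 1,
        forall r s, r <= s -> m [set x | G s x < G r x] = 0%E &
        forall r B, measurable B -> (\int[m]_(x in B) (G r x)%:E)%E =
          al (B `*` [set y | y <= ratr r])].
Proof.
move=> mE.
pose low (r : rat) := [set y : R | y <= ratr r].
have mlow (r : rat) : measurable (low r).
  by rewrite /low -set_itvNyc; exact: measurable_itv.
have /choice [g gP] (r : rat) : exists g : X -> \bar R,
    [/\ forall x, (0 <= g x)%E, forall x, g x \is a fin_num,
       m.-integrable setT g &
       forall B, measurable B ->
         al (B `*` low r) = (\int[m]_(x in B) g x)%E].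
  have [al_r al_rE] := finite_measure_restr al
    (measurableX (@measurableT _ X) (mlow r)).
  have [nu nuE] := finite_measure_pushforward al_r (@measurable_fst _ _ X R).
  have nuB B : nu B = al (B `*` low r).
    rewrite nuE al_rE; congr (al _).
    by apply/seteqP; split=> [[x y] [/= ? []]|[x y] []].
  have num : nu `<< m.
    apply/null_content_dominatesP => B mB mB0; rewrite nuB.
    have : (al (B `*` low r) <= al (B `*` setT))%E.
      apply: le_measure; rewrite ?inE; [exact: measurableX|exact: measurableX|].
      by move=> [x y] [].
    by rewrite -mE// mB0 measure_le0 => /eqP.
  have [g [g0 gfin gint gE]] := radon_nikodym_sigma_finite num.
  by exists g; split=> // B mB; rewrite -nuB gE.
(* Truncation at 1 gives a bound valid everywhere; it changes the derivative only on a null set,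
   since the differentiated measure is at most [m]. *)
pose G r x := fine (mine (g r x) 1%E).
have GE r x : (G r x)%:E = mine (g r x) 1%E.
  rewrite /G fineK// /mine; have [_ gfin _ _] := gP r.
  by case: ifP.
have mG r : measurable_fun setT (fun x => (G r x)%:E).
  under eq_fun do rewrite GE.
  by apply: measurable_mine => //; have [_ _ /measurable_int] := gP r.
have GI r B : measurable B ->
    (\int[m]_(x in B) (G r x)%:E)%E = al (B `*` low r).
  move=> mB; have [_ gfin gint gE] := gP r.
  rewrite gE//; apply: ae_eq_integral => //; first exact: measurable_funTS.
    by apply: measurable_funTS; exact: measurable_int gint.
  have m1 : m [set x | (1 < g r x)%E] = 0%E.
    apply: (@lt_set_null _ _ _ _ (g r) (cst 1%E)) => //.
      exact: finite_measure_integrable_cst.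
    move=> C mC; rewrite -gE// integral_cst// mul1e [leRHS](mE _ mC).
    apply: le_measure; rewrite ?inE; [exact: measurableX|exact: measurableX|].
    by move=> [x y] [].
  exists [set x | (1 < g r x)%E]; split=> //.
    rewrite -[X in measurable X]setTI; apply: measurable_lte => //.
    exact: measurable_int gint.
  move=> x /= nE; rewrite ltNge; apply/negP => g1; apply: nE => _.
  by rewrite GE; apply/min_idPl.
have Gint r : m.-integrable setT (fun x => (G r x)%:E).
  have [g0 _ gint _] := gP r; apply: le_integrable gint => // x _.
  rewrite GE !gee0_abs//; last by rewrite le_min g0/=.
  by rewrite ge_min lexx.
exists G; split=> //.
- by move=> r; apply/measurable_EFinP; exact: mG.
- move=> r x; have [g0 _ _ _] := gP r.
  by rewrite -!lee_fin GE le_min g0 lee01 ge_min lexx orbT.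
- move=> r s rs.
  have -> : [set x | G s x < G r x] =
    [set x | ((G s x)%:E < (G r x)%:E)%E] by [].
  apply: lt_set_null => // B mB; rewrite !GI//.
  apply: le_measure; rewrite ?inE; [exact: measurableX|exact: measurableX|].
  by move=> [x y] [/= ? yr]; split=> //; apply: le_trans yr _; rewrite ler_rat.
Qed.

Lemma bigcup_unpickle (I : countType) (T : Type) (D : set I) (F : I -> set T) :
  \bigcup_(i in D) F i =
  \bigcup_k (if unpickle k is Some i then [set x | D i /\ F i x] else set0).
Proof.
apply/seteqP; split=> [x [i Di Fi]|x [k _]].
  by exists (pickle i) => //; rewrite pickleK.
by case: unpickle => // i [Di Fi]; exists i.
Qed.

Lemma countable_bigcup_measurable d (T : measurableType d) (I : countType)
  (D : set I) (F : I -> set T) :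
  (forall i, measurable (F i)) -> measurable (\bigcup_(i in D) F i).
Proof.
move=> mF; rewrite bigcup_unpickle; apply: bigcupT_measurable => k.
case: unpickle => // i; have [Di|nDi] := pselect (D i).
  by rewrite (_ : [set x | _] = F i)//; apply/seteqP; split=> x // [].
by rewrite (_ : [set x | _] = set0)//; apply/seteqP; split=> x // [].
Qed.

Lemma countable_bigcup_null d (T : measurableType d) (R : realType)
  (mu : {measure set T -> \bar R}) (I : countType) (D : set I)
  (F : I -> set T) :
  (forall i, measurable (F i)) -> (forall i, D i -> mu (F i) = 0%E) ->
  mu (\bigcup_(i in D) F i) = 0%E.
Proof.
move=> mF F0; apply/negligibleP; first exact: countable_bigcup_measurable.
rewrite bigcup_unpickle; apply: negligible_bigcup => k.
case: unpickle => [i|]; last exact: negligible_set0.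
have [Di|nDi] := pselect (D i).
  apply: (@negligibleS _ _ _ _ (F i)); first by move=> x [].
  by apply/negligibleP => //; exact: F0.
rewrite (_ : [set x | _] = set0); first exact: negligible_set0.
by apply/seteqP; split=> x // [].
Qed.

(** An enumeration of the rationals does not respect their order, but a finite union of members of a
    chain is empty or again a member, with the same index on both sides; continuity from below then
    passes to the full union. *)
Lemma measure_bigcup_chain d1 d2 (T1 : measurableType d1)
  (T2 : measurableType d2) (R : realType) (mu : {measure set T1 -> \bar R})
  (nu : {measure set T2 -> \bar R}) (E : rat -> set T1) (H : rat -> set T2)
  (D : set rat) :
  (forall r, measurable (E r)) -> (forall r, measurable (H r)) ->
  {homo E : r s / r <= s >-> r `<=` s} ->
  {homo H : r s / r <= s >-> r `<=` s} ->
  (forall r, mu (E r) = nu (H r)) ->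
  mu (\bigcup_(r in D) E r) = nu (\bigcup_(r in D) H r).
Proof.
move=> mE mH ndE ndH muE.
pose part (T : Type) (F : rat -> set T) k : set T :=
  if unpickle k is Some r then [set x | D r /\ F r x] else set0.
rewrite (bigcup_unpickle D E) (bigcup_unpickle D H) -/(part _ E) -/(part _ H).
rewrite -(bigcup_bigsetU_bigcup (part _ E)) -(bigcup_bigsetU_bigcup (part _ H)).
have partP k : (part _ E k = set0 /\ part _ H k = set0) \/
    exists r, part _ E k = E r /\ part _ H k = H r.
  rewrite /part; case: unpickle => [r|]; last by left.
  have [Dr|nDr] := pselect (D r); [right; exists r|left]; split;
    by apply/seteqP; split=> x // [].
have unionP n : (\big[setU/set0]_(i < n) part _ E i = set0 /\
      \big[setU/set0]_(i < n) part _ H i = set0) \/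
    exists r, \big[setU/set0]_(i < n) part _ E i = E r /\
      \big[setU/set0]_(i < n) part _ H i = H r.
  elim: n => [|n IHn]; first by left; rewrite !big_ord0.
  rewrite !big_ord_recr/=.
  have [[-> ->]|[s [-> ->]]] := partP n; first by rewrite !setU0.
  right; case: IHn => [[-> ->]|[r [-> ->]]]; first by exists s; rewrite !set0U.
  have [rs|/ltW sr] := leP r s.
    by exists s; rewrite !setUidr//; [exact: ndH|exact: ndE].
  by exists r; rewrite !setUidl//; [exact: ndH|exact: ndE].
have cvgmu := @nondecreasing_cvg_mu _ _ _ mu
  (fun n => \big[setU/set0]_(i < n.+1) part _ E i).
have cvgnu := @nondecreasing_cvg_mu _ _ _ nu
  (fun n => \big[setU/set0]_(i < n.+1) part _ H i).
have mEn n : measurable (\big[setU/set0]_(i < n.+1) part _ E i).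
  by have [[-> _]|[r [-> _]]] := unionP n.+1.
have mHn n : measurable (\big[setU/set0]_(i < n.+1) part _ H i).
  by have [[_ ->]|[r [_ ->]]] := unionP n.+1.
have ndn T (F : rat -> set T) :
    nondecreasing_seq (fun n => \big[setU/set0]_(i < n.+1) part _ F i).
  by move=> p q pq; apply/subsetPset; exact: subset_bigsetU.
have {}cvgmu := cvgmu mEn (bigcupT_measurable _ mEn) (ndn _ E).
have {}cvgnu := cvgnu mHn (bigcupT_measurable _ mHn) (ndn _ H).
rewrite -(cvg_lim _ cvgmu)// -(cvg_lim _ cvgnu)//; congr (limn _).
apply/funext => n /=.
by have [[-> ->]|[r [-> ->]]] := unionP n.+1; rewrite ?measure0.
Qed.

(* Conditional quantile transform: [h (x, u)] is the [u]-quantile of the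
   conditional law of the second coordinate given that the first one is [x]. *)
Lemma conditional_quantile d (X : measurableType d) (R : realType)
  (al : {finite_measure set (X * R)%type -> \bar R})
  (m : {finite_measure set X -> \bar R}) :
  (forall B, measurable B -> m B = al (B `*` setT)) ->
  exists2 h : X * measurableTypeR R -> R, measurable_fun setT h &
    forall C, measurable C ->
      (m \x uniform_prob (@ltr01 R))%E [set z | C (z.1, h z)] = al C.
Proof.
move=> mE; have [G [mG G01 GM GI]] := conditional_cdf mE.
pose M : {measure set (X * measurableTypeR R)%type -> \bar R} :=
  (m \x uniform_prob (@ltr01 R))%E.
(* For a genuine conditional distribution function, [E r] would be the event that the [u]-quantile
   at [x] is at most [r]. *)
pose E r : set (X * measurableTypeR R)%type := [set z | z.2 <= G r z.1].
have mE0 r : measurable (E r).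
  rewrite -[E r]setTI; apply: measurable_fun_le => //.
  exact: measurableT_comp (mG r) measurable_fst.
(* Since [G] is monotone only almost everywhere, the sets [E r] need not increase with [r]; the
   unions [F r] do, and [MF] shows that nothing is gained in measure. *)
pose F r := \bigcup_(s in [set s | s <= r]) E s.
have mF r : measurable (F r) by exact: countable_bigcup_measurable.
pose low (r : rat) := [set y : R | y <= ratr r].
have mlow r : measurable (low r).
  by rewrite /low -set_itvNyc; exact: measurable_itv.
have ME r A : measurable A -> M (A `*` setT `&` E r) = al (A `*` low r).
  move=> mA; rewrite -GI// /M /= /product_measure1 [RHS]integral_mkcond.
  apply: eq_integral => x _ /=; rewrite patchE; case: ifPn => [/set_mem xA|].
    rewrite -uniform_prob_le//; congr (uniform_prob _ _).
    by apply/seteqP; split=> u; rewrite /xsection/= inE /E/=; [move=> []|].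
  rewrite notin_setE => xA.
  rewrite (_ : xsection _ _ = set0) ?measure0//.
  by apply/seteqP; split=> u //; rewrite /xsection/= inE /= => -[[]].
have MF r A : measurable A -> M (A `*` setT `&` F r) = al (A `*` low r).
  move=> mA; transitivity (M (A `*` setT `&` E r)); last exact: ME.
  (* [N] collects the points where monotonicity fails at [r]; outside the strip over [N], the sets
     [F r] and [E r] coincide. *)
  pose N := \bigcup_(s in [set s | s <= r]) [set x | G r x < G s x].
  have mGlt s : measurable [set x | G r x < G s x].
    rewrite -[X in measurable X]setTI.
    have -> : [set x | G r x < G s x] =
      [set x | ((G r x)%:E < (G s x)%:E)%E] by [].
    by apply: measurable_lte => //; exact/measurable_EFinP.
  have mN : measurable N by exact: countable_bigcup_measurable.
  have N0 : m N = 0%E by apply: countable_bigcup_null => // s sr; exact: GM.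
  have mAT : measurable (A `*` @setT (measurableTypeR R)) by exact: measurableX.
  have mNT : measurable (N `*` @setT (measurableTypeR R)) by exact: measurableX.
  have mAF : measurable (A `*` @setT (measurableTypeR R) `&` F r).
    exact: measurableI.
  have mAE : measurable (A `*` @setT (measurableTypeR R) `&` E r).
    exact: measurableI.
  apply/eqP; rewrite eq_le; apply/andP; split; last first.
    apply: le_measure; rewrite ?inE//; apply: setIS => z Ez.
    by exists r => //=.
  have MN0 : M (N `*` setT) = 0%E.
    by rewrite /M /= product_measure1E// [X in (X * _)%E]N0 mul0e.
  rewrite -[leRHS]adde0 -MN0; apply: le_trans (measureU2 M mAE mNT).
  apply: le_measure; rewrite ?inE//; first exact: measurableU.
  move=> z [Az [s sr Es]]; have [Er|nEr] := pselect (E r z); first by left.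
  right; split=> //; exists s => //=; rewrite ltNge; apply/negP => sr'.
  by apply: nEr; exact: le_trans Es sr'.
(* The infimum lives in the extended reals because it may be infinite, for instance when no [G r x]
   reaches [u]. *)
pose q (z : X * measurableTypeR R) : \bar R :=
  ereal_inf [set (ratr r)%:E | r in [set r | E r z]].
have q_lt y : [set z | (q z < y%:E)%E] =
    \bigcup_(r in [set r | ratr r < y]) F r.
  apply/seteqP; split=> [z /ereal_inf_ltP[_ [r Er <-]] ry|z [r ry [s sr Es]]].
    by exists r => //; exists r => //=.
  apply/ereal_inf_ltP; exists (ratr s)%:E; first by exists s.
  by rewrite lte_fin (le_lt_trans _ ry)// ler_rat.
have mq : measurable_fun setT q.
  apply: (measurability _ (ErealGenInftyO.measurableE R)).
  move=> _ [_ [y ->] <-]; rewrite setTI.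
  rewrite (_ : _ @^-1` _ = [set z | (q z < y%:E)%E]).
    by rewrite q_lt; exact: countable_bigcup_measurable.
  by apply/seteqP; split=> z /=; rewrite in_itv.
have ray A y : measurable A ->
    M (A `*` setT `&` [set z | (q z < y%:E)%E]) = al (A `*` [set u | u < y]).
  move=> mA; rewrite q_lt setI_bigcupr.
  have -> : A `*` [set u | u < y] =
      \bigcup_(r in [set r | ratr r < y]) (A `*` low r).
    apply/seteqP; split=> [[x u] [/= Ax uy]|[x u] [r /= ry [/= Ax ur]]].
      have [r] := rat_in_itvoo uy.
      by rewrite in_itv/= => /andP[/ltW ur ry]; exists r.
    by split=> //=; exact: le_lt_trans ur ry.
  apply: measure_bigcup_chain.
  - by move=> r; apply: measurableI => //; exact: measurableX.
  - by move=> r; exact: measurableX.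
  - move=> r s rs; apply: setIS => z [t tr Et].
    by exists t => //=; exact: le_trans tr rs.
  - move=> r s rs [x u] [/= Ax ur]; split=> //=.
    by apply: le_trans ur _; rewrite ler_rat.
  - by move=> r; exact: MF.
have allT A : measurable A -> M (A `*` setT) = al (A `*` setT).
  move=> mA; rewrite /M /= product_measure1E//.
  by rewrite [X in (_ * X)%E]probability_setT mule1; exact: mE.
have qE A B : measurable A -> measurable B ->
    M (A `*` setT `&` q @^-1` B) = al (A `*` [set y | B y%:E]).
  move=> mA mB.
  have mAT : measurable (A `*` @setT (measurableTypeR R)) by exact: measurableX.
  have mAT' : measurable (A `*` @setT R) by exact: measurableX.
  have [nu1 nu1E] := measure_pushforward (mrestr M mAT) mq.
  have [alA alAE] := finite_measure_restr al mAT'.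
  have mEsnd : measurable_fun setT (EFin \o snd : X * R -> \bar R).
    exact: measurableT_comp.
  have [nu2 nu2E] := measure_pushforward alA mEsnd.
  have nu1A C : nu1 C = M (A `*` setT `&` q @^-1` C).
    by rewrite nu1E /mrestr setIC.
  have nu2A C : nu2 C = al (A `*` [set y | C y%:E]).
    rewrite nu2E [LHS](alAE _); congr (al _).
    by apply/seteqP; split=> [[x y] [/= Cy [Ax _]]|[x y] [/= Ax Cy]].
  rewrite -nu1A -nu2A.
  (* The half-lines [[-oo, y[] form a generating pi-system of the extended reals; the whole space is
     added to supply the exhausting sequence of finite measure. *)
  apply: (measure_unique (setT |` @ErealGenInftyO.G R) (fun=> setT)) => //.
  - rewrite eqEsubset; split.
      rewrite [X in X `<=` _](ErealGenInftyO.measurableE R).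
      by apply: sub_sigma_algebra2 => C GC; right.
    apply: smallest_sub; first exact: sigma_algebra_measurable.
    by move=> _ [->|[y ->]]; [exact: measurableT|exact: emeasurable_itv].
  - move=> C D [->|[y ->]] [->|[y' ->]].
    + by left; rewrite setIT.
    + by right; exists y'; rewrite setTI.
    + by right; exists y; rewrite setIT.
    + right; exists (Num.min y y'); apply/seteqP; split=> z /=; rewrite !in_itv/=.
        by rewrite EFin_min lt_min => -[-> ->].
      by rewrite EFin_min lt_min => /andP[].
  - by move=> k; left.
  - by rewrite bigcup_const.
  - move=> C; rewrite nu1A nu2A => -[->|[y ->]].
      by rewrite preimage_setT setIT allT.
    transitivity (M (A `*` setT `&` [set z | (q z < y%:E)%E])).
      by congr (M (_ `&` _)); apply/seteqP; split=> z /=; rewrite in_itv.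
    by rewrite ray.
  - move=> _; rewrite nu1A preimage_setT setIT allT// ltey_eq.
    by rewrite fin_num_measure.
(* Replacing infinite values by the default 0 is harmless: by [qE], only the real points of a set
   count for the law of [q]. *)
exists (fine \o q).
  by apply: measurableT_comp => //; exact: fine_measurable.
move=> C mC.
have mfq : measurable_fun setT
    (fun z : X * measurableTypeR R => (z.1, fine (q z))).
  apply: measurable_fun_pair => //.
  by apply: measurableT_comp => //; exact: fine_measurable.
have [nu nuE] := measure_pushforward M mfq.
transitivity (nu C); first by rewrite nuE.
apply: (measure_unique
  [set A `*` B | A in measurable & B in measurable] (fun=> setT)) => //.
- exact: measurable_prod_measurableType.
- move=> _ _ [A mA [B mB <-]] [A' mA' [B' mB' <-]].
  rewrite -setXI; exists (A `&` A'); first exact: measurableI.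
  by exists (B `&` B'); first exact: measurableI.
- by move=> _; exists setT => //; exists setT => //; rewrite setXTT.
- by rewrite bigcup_const.
- move=> _ [A mA [B mB <-]].
  have mB' : measurable (fine @^-1` B : set (\bar R)).
    by rewrite -[X in measurable X]setTI; exact: fine_measurable.
  rewrite nuE; transitivity (M (A `*` setT `&` q @^-1` (fine @^-1` B))).
    congr (M _).
    by apply/seteqP; split=> [z [/= Az Bz]|z [/= [Az _] Bz]].
  exact: qE.
- move=> _; rewrite nuE preimage_setT -setXTT allT// setXTT ltey_eq.
  by rewrite fin_num_measure.
Qed.

(** * Laws and arms of a study *)

Lemma ge0_integral_law d1 d2 (T : measurableType d1) (T' : measurableType d2)
  (R : realType) (mu : {measure set T -> \bar R})
  (nu : {measure set T' -> \bar R}) (phi : T -> T') (f : T' -> \bar R) A :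
  measurable_fun setT phi ->
  (forall B, measurable B -> mu (phi @^-1` B) = nu B) ->
  measurable_fun setT f -> (forall y, 0 <= f y)%E -> measurable A ->
  (\int[mu]_(x in phi @^-1` A) f (phi x) = \int[nu]_(y in A) f y)%E.
Proof.
move=> mphi munu mf f0 mA.
have mE := ge0_integral_pushforward mphi mu mA (measurable_funTS mf)
  (fun y _ => f0 y).
rewrite -[LHS]mE; apply: eq_measure_integral => B mB _; exact: munu.
Qed.

Lemma integral_law d1 d2 (T : measurableType d1) (T' : measurableType d2)
  (R : realType) (mu : {measure set T -> \bar R})
  (nu : {measure set T' -> \bar R}) (phi : T -> T') (f : T' -> \bar R) :
  measurable_fun setT phi ->
  (forall B, measurable B -> mu (phi @^-1` B) = nu B) ->
  nu.-integrable setT f ->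
  mu.-integrable setT (f \o phi) /\
  (\int[mu]_x f (phi x) = \int[nu]_y f y)%E.
Proof.
move=> mphi munu intf; have mf := measurable_int _ intf.
have intfphi : mu.-integrable setT (f \o phi).
  apply/integrableP; split; first exact: measurableT_comp.
  rewrite -(preimage_setT phi).
  rewrite (@ge0_integral_law _ _ _ _ _ mu nu phi (fun y => `|f y|)%E)//.
    by have /integrableP[] := intf.
  exact: measurableT_comp.
split=> //.
have mE := @integral_pushforward _ _ _ _ _ _ mphi mu setT _ mf.
rewrite preimage_setT in mE; rewrite -[LHS](mE intfphi measurableT).
by apply: eq_measure_integral => B mB _; exact: munu.
Qed.

Section Studies.
Context {R : realType} {d : nat}.
Implicit Types (D : Study R d) (P Q : Dist R d) (p q : CovOut R d -> R).

Lemma measurable_covX : measurable_fun setT (@covX R d).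
Proof.
apply: (measurableT_comp measurable_fst).
exact: measurableT_comp measurable_fst measurable_fst.
Qed.

Lemma measurable_trt : measurable_fun setT (@trt R d).
Proof.
apply: (measurableT_comp measurable_snd).
exact: measurableT_comp measurable_fst measurable_fst.
Qed.

Lemma measurable_Yof t : measurable_fun setT (@Yof R d t).
Proof.
case: t; first exact: measurable_snd.
exact: measurableT_comp measurable_snd measurable_fst.
Qed.

Lemma measurable_XY t : measurable_fun setT (@XY R d t).
Proof.
by apply: measurable_fun_pair; [exact: measurable_covX|exact: measurable_Yof].
Qed.

Lemma measurable_cens : measurable_fun setT (@cens R d).
Proof.
apply: measurable_fun_pair.
  by apply: measurable_fun_pair; [exact: measurable_covX|exact: measurable_trt].
have -> : (fun w => @Yof R d (trt w) w) =
    (fun w => if trt w then Yof true w else Yof false w).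
  by apply/funext => w; case: (trt w).
by apply: measurable_fun_ifT; [exact: measurable_trt|exact: measurable_Yof..].
Qed.

Lemma measurable_arm t : measurable [set w : Omega R d | trt w = t].
Proof.
rewrite -[X in measurable X]setTI.
exact: (measurable_trt measurableT (Y := [set t])).
Qed.

Lemma measurable_XY_preimage t (A : set (CovOut R d)) :
  measurable A -> measurable (@XY R d t @^-1` A).
Proof.
by move=> mA; rewrite -[X in measurable X]setTI; exact: measurable_XY.
Qed.

(** Change of variables along [XY t]: the score becomes the density, with respect to the law of (X,
    Y(t)), of the measure that arm [t] induces on covariates and outcome. *)
Lemma is_propensityE D t P p : law_is D t P -> (forall z, 0 <= p z) ->
  is_propensity D t p <-> (measurable_fun setT p /\
    forall A, measurable A -> D ([set w | trt w = t] `&` XY t @^-1` A) =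
      (\int[P]_(z in A) (p z)%:E)%E).
Proof.
move=> lawP p0; rewrite /is_propensity.
have pI A : measurable_fun setT p -> measurable A ->
    (\int[D]_(w in XY t @^-1` A) (p (XY t w))%:E =
     \int[P]_(z in A) (p z)%:E)%E.
  move=> mp mA; apply: (ge0_integral_law (f := EFin \o p)) => //.
    exact: measurable_XY.
  exact/measurable_EFinP.
by split=> -[mp pE]; split=> // A mA; rewrite pE// pI.
Qed.

Lemma ATE_law D P0 P1 : law_is D false P0 -> law_is D true P1 ->
  P0.-integrable setT (fun z : CovOut R d => (z.2)%:E) ->
  P1.-integrable setT (fun z : CovOut R d => (z.2)%:E) ->
  ATE D = (meanY P1 - meanY P0)%E.
Proof.
move=> law0 law1 int0 int1; rewrite /ATE /meanY.
have [i0 <-] := integral_law (@measurable_XY false) law0 int0.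
have [i1 <-] := integral_law (@measurable_XY true) law1 int1.
by rewrite -integralB.
Qed.

Lemma meanY_fin_num P : P.-integrable setT (fun z : CovOut R d => (z.2)%:E) ->
  meanY P \is a fin_num.
Proof. exact: integrable_fin_num. Qed.

(** In arm [t] the observed outcome is Y(t), so the event is the preimage under [cens] of a set of
    censored observations. *)
Lemma censored_eq_arm D D' t (A : set (CovOut R d)) :
  censored D = censored D' -> measurable A ->
  D ([set w | trt w = t] `&` XY t @^-1` A) =
  D' ([set w | trt w = t] `&` XY t @^-1` A).
Proof.
move=> eqC mA.
pose C : set (Cens R d) := [set c | c.1.2 = t /\ A (c.1.1, c.2)].
have mC : measurable C.
  apply: measurableI.
    rewrite -[X in measurable X]setTI.
    have mt : measurable_fun setT (fun c : Cens R d => c.1.2).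
      exact: measurableT_comp measurable_snd measurable_fst.
    exact: (mt measurableT [set t]).
  rewrite -[X in measurable X]setTI.
  have mxy : measurable_fun setT (fun c : Cens R d => (c.1.1, c.2)).
    apply: measurable_fun_pair => //.
    exact: measurableT_comp measurable_fst measurable_fst.
  exact: mxy.
have -> : [set w : Omega R d | trt w = t] `&` XY t @^-1` A = @cens R d @^-1` C.
  by apply/seteqP; split=> w; rewrite /cens /C /XY /= => -[<-].
by have := congr1 (@^~ C) eqC; rewrite /censored; case: pselect.
Qed.

Lemma censored_eq_covX D D' (B : set (Cov R d)) :
  censored D = censored D' -> measurable B ->
  D (@covX R d @^-1` B) = D' (@covX R d @^-1` B).
Proof.
move=> eqC mB.
pose C : set (Cens R d) := [set c | B c.1.1].
have mC : measurable C.
  rewrite -[X in measurable X]setTI.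
  have mx : measurable_fun setT (fun c : Cens R d => c.1.1).
    exact: measurableT_comp measurable_fst measurable_fst.
  exact: mx.
by have := congr1 (@^~ C) eqC; rewrite /censored; case: pselect.
Qed.

Lemma margX_law D t P B : law_is D t P -> measurable B ->
  margX P B = D (@covX R d @^-1` B).
Proof.
move=> lawP mB; rewrite /margX -lawP; last exact: measurableX.
by congr (D _); apply/seteqP; split=> w; [case|].
Qed.

(** * Modifying a study *)

(** The arms and the potential outcomes are exchanged at once. Compatibility lets a tuple belong to
    either arm; this symmetry brings both tuples of a violation into the control arm. *)
Lemma study_has_swap D p0 p1 P0 P1 :
  (forall z, 0 <= p0 z) -> (forall z, 0 <= p1 z) ->
  study_has D p0 p1 P0 P1 -> exists D', study_has D' p1 p0 P1 P0.
Proof.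
move=> p0_ge0 p1_ge0 [prop0 prop1 law0 law1].
pose swap (w : Omega R d) : Omega R d := (covX w, ~~ trt w, w.2, w.1.2).
have mswap : measurable_fun setT swap.
  apply: measurable_fun_pair; last first.
    exact: measurableT_comp measurable_snd measurable_fst.
  apply: measurable_fun_pair; last exact: measurable_snd.
  apply: measurable_fun_pair; first exact: measurable_covX.
  exact: measurable_neg measurable_trt.
have [D' D'E] := probability_pushforward D mswap.
have [m0 E0] := (is_propensityE law0 p0_ge0).1 prop0.
have [m1 E1] := (is_propensityE law1 p1_ge0).1 prop1.
have law0' : law_is D' false P1.
  by move=> A mA; rewrite D'E -law1.
have law1' : law_is D' true P0.
  by move=> A mA; rewrite D'E -law0.
exists D'; split=> //.
- apply/is_propensityE; [exact: law0'|exact: p1_ge0|split=> // A mA].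
  rewrite D'E -E1//; congr (D _).
  by apply/seteqP; split=> w; rewrite /swap/= => -[wt Aw]; split=> //=;
    move: wt; rewrite /trt/=; case: w.1.1.2.
- apply/is_propensityE; [exact: law1'|exact: p0_ge0|split=> // A mA].
  rewrite D'E -E0//; congr (D _).
  by apply/seteqP; split=> w; rewrite /swap/= => -[wt Aw]; split=> //=;
    move: wt; rewrite /trt/=; case: w.1.1.2.
Qed.

(* Only the unobserved outcome Y(0) of the treated units of [D1] is resampled,
   from its conditional law given X among the treated units of [D2]. *)
Lemma study_splice D1 D2 p q p1 q1 P Q P1 Q1 :
  (forall z, 0 <= p z) -> (forall z, 0 <= q z) -> (forall z, 0 <= p1 z) ->
  study_has D1 p p1 P P1 -> study_has D2 q q1 Q Q1 ->
  (forall B, measurable B -> margX P B = margX Q B) ->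
  (forall A, measurable A ->
    (\int[P]_(z in A) (p z)%:E = \int[Q]_(z in A) (q z)%:E)%E) ->
  exists2 D', study_has D' q p1 Q P1 & censored D' = censored D1.
Proof.
move=> p_ge0 q_ge0 p1_ge0 [propp propp1 lawP lawP1] [propq _ lawQ _] margPQ pq.
have [mp Ep] := (is_propensityE lawP p_ge0).1 propp.
have [mp1 Ep1] := (is_propensityE lawP1 p1_ge0).1 propp1.
have [mq Eq] := (is_propensityE lawQ q_ge0).1 propq.
have [D2t D2tE] := finite_measure_restr D2 (@measurable_arm true).
have [D1t D1tE] := finite_measure_restr D1 (@measurable_arm true).
(* [al] is the law of (X, Y(0)) on the treated units of [D2], and [m] the law of X on the treated
   units of [D1]; neither is normalised. *)
have [al alE] := finite_measure_pushforward D2t (@measurable_XY false).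
have [m mE] := finite_measure_pushforward D1t (@measurable_covX).
have armS (D : Study R d) (S : set (Omega R d)) : measurable S ->
    D S = (D (S `&` [set w | trt w = true]) +
           D ([set w | trt w = false] `&` S))%E.
  move=> mS; rewrite -measureU.
  - congr (D _); apply/seteqP; split=> [w Sw|w [[]|[]]//].
    by case E: (trt w); [left|right].
  - by apply: measurableI => //; exact: measurable_arm.
  - by apply: measurableI => //; exact: measurable_arm.
  - by apply/seteqP; split=> w // [[_ /= ->] []].
(* The laws of X agree on all units by [margPQ] and on the control units by [pq]; subtracting finite
   masses leaves agreement on the treated units. *)
have mal B : measurable B -> m B = al (B `*` setT).
  move=> mB; rewrite mE alE [LHS](D1tE _) [RHS](D2tE _).
  have mBT : measurable (B `*` @setT R) by exact: measurableX.
  have XB : @XY R d false @^-1` (B `*` setT) = @covX R d @^-1` B.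
    by apply/seteqP; split=> w; [case|].
  have mX : measurable (@covX R d @^-1` B).
    by rewrite -XB; exact: measurable_XY_preimage.
  rewrite XB.
  have : D1 (@covX R d @^-1` B) = D2 (@covX R d @^-1` B).
    by rewrite -(margX_law lawP mB) -(margX_law lawQ mB) margPQ.
  rewrite (armS D1)// (armS D2)//.
  pose S0 : set (Omega R d) := [set w | trt w = false] `&` @covX R d @^-1` B.
  have mS0 : measurable S0 by apply: measurableI => //; exact: measurable_arm.
  rewrite -/S0 (_ : D1 S0 = D2 S0); last by rewrite /S0 -XB Ep// Eq// pq.
  move=> /(congr1 (fun e => e - D2 S0)%E).
  by rewrite !addeK// fin_num_measure.
have [h mh hE] := conditional_quantile mal.
pose U := uniform_prob (@ltr01 R).
pose splice (v : Omega R d * measurableTypeR R) : Omega R d :=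
  (covX v.1, trt v.1, if trt v.1 then h (covX v.1, v.2) else v.1.1.2, v.1.2).
have XY_control v : trt v.1 = false -> XY false (splice v) = XY false v.1.
  by rewrite /splice => ->.
have XY_treated v : trt v.1 = true ->
    XY false (splice v) = (covX v.1, h (covX v.1, v.2)).
  by rewrite /splice => ->.
have censS v : cens (splice v) = cens v.1.
  by rewrite /cens /splice /covX /trt /Yof/=; case: v.1.1.1.2.
have msplice : measurable_fun setT splice.
  have m1 : measurable_fun setT (fun v : Omega R d * measurableTypeR R => v.1).
    exact: measurable_fst.
  have mX1 := measurableT_comp (@measurable_covX) m1.
  have mT1 := measurableT_comp (@measurable_trt) m1.
  apply: measurable_fun_pair; last exact: measurableT_comp measurable_snd m1.
  apply: measurable_fun_pair; first exact: measurable_fun_pair.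
  apply: measurable_fun_ifT; [exact: mT1| |].
    apply: (measurableT_comp mh); apply: measurable_fun_pair => //.
  exact: measurableT_comp (@measurable_Yof false) m1.
have [D' D'E] := probability_pushforward (D1 \x U)%E msplice.
(* An event whose preimage under [splice] ignores the uniform coordinate keeps its probability under
   [D1]. *)
have unchanged (S' S : set (Omega R d)) : measurable S ->
    splice @^-1` S' = S `*` setT -> D' S' = D1 S.
  move=> mS S'E; rewrite D'E S'E [LHS]product_measure1E//.
  by rewrite [X in (_ * X)%E]probability_setT mule1.
have armC D t A : measurable A ->
    D (@XY R d t @^-1` A) = (D (XY t @^-1` A `&` [set w | trt w = true]) +
      D ([set w | trt w = false] `&` XY t @^-1` A))%E.
  by move=> mA; apply: armS; exact: measurable_XY_preimage.
have lawP1' : law_is D' true P1.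
  move=> A mA; rewrite -lawP1//; apply: unchanged.
    exact: measurable_XY_preimage.
  by apply/seteqP; split=> v; [|case].
have untreated A : measurable A ->
    D' ([set w | trt w = false] `&` XY false @^-1` A) =
    (\int[Q]_(z in A) (q z)%:E)%E.
  move=> mA; rewrite -pq// -Ep//; apply: unchanged.
    by apply: measurableI; [exact: measurable_arm|exact: measurable_XY_preimage].
  apply/seteqP; split=> v.
    by move=> [v0]; rewrite /preimage /mkset XY_control.
  by move=> [[v0 Av] _]; split=> //; rewrite /preimage /mkset XY_control.
have treated A : measurable A ->
    D' (XY false @^-1` A `&` [set w | trt w = true]) =
    D2 (XY false @^-1` A `&` [set w | trt w = true]).
  move=> mA; rewrite -[RHS]D2tE -[RHS]alE -[RHS]hE//.
  have marmT : measurable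
      ([set w : Omega R d | trt w = true] `*` @setT (measurableTypeR R)).
    exact: (measurableX (@measurable_arm true) measurableT).
  have mcov : measurable_fun setT
      (fun v : Omega R d * measurableTypeR R => (covX v.1, v.2)).
    apply: measurable_fun_pair => //.
    exact: measurableT_comp (@measurable_covX) measurable_fst.
  (* [nu] is the joint law of X and the uniform variable on the treated units; independence makes it
     the product of [m] and [U], the measure appearing in [hE]. *)
  have [nu nuE] := measure_pushforward (mrestr (D1 \x U)%E marmT) mcov.
  have nuX (B : set (Cov R d)) (V : set (measurableTypeR R)) :
      measurable B -> measurable V -> nu (B `*` V) = (m B * U V)%E.
    move=> mB mV; rewrite mE [X in (X * _)%E](D1tE _) nuE /mrestr.
    transitivity ((D1 \x U)%E
        ((@covX R d @^-1` B `&` [set w | trt w = true]) `*` V)).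
      congr ((D1 \x U)%E _).
      by apply/seteqP; split=> [v [/= [? ?] [? _]]|v [/= [? ?] ?]].
    apply: product_measure1E => //.
    apply: measurableI; last exact: measurable_arm.
    by rewrite -[X in measurable X]setTI; exact: measurable_covX.
  rewrite (product_measure_unique nuX); last first.
    rewrite -[X in measurable X]setTI.
    have mg : measurable_fun setT
        (fun z : Cov R d * measurableTypeR R => (z.1, h z)).
      by apply: measurable_fun_pair.
    exact: mg.
  rewrite nuE /mrestr D'E; congr ((D1 \x U)%E _).
  apply/seteqP; split=> v.
    by move=> [+ vt]; rewrite /preimage /mkset XY_treated.
  by move=> [Av [vt _]]; split=> //; rewrite /preimage /mkset XY_treated.
(* The control parts of [D'] and [D2] are both the integral of [q] against [Q], and the treated
   parts agree by resampling; their sum is the law of (X, Y(0)) under [D2]. *)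
have lawQ' : law_is D' false Q.
  by move=> A mA; rewrite armC// untreated// treated// -Eq// -armC// lawQ.
exists D'; first split=> //.
- by apply/is_propensityE; [exact: lawQ'|exact: q_ge0|].
- apply/is_propensityE; [exact: lawP1'|exact: p1_ge0|split=> // A mA].
  rewrite -Ep1//; apply: unchanged.
    by apply: measurableI; [exact: measurable_arm|exact: measurable_XY_preimage].
  by apply/seteqP; split=> v; [|case].
apply/funext => A; rewrite /censored; case: pselect => // mA.
apply: unchanged.
  by rewrite -[X in measurable X]setTI; exact: measurable_cens.
by apply/seteqP; split=> v; [|case]; rewrite /preimage /mkset censS.
Qed.

End Studies.

(** * The support of the covariates *)

Section Support.
Context {R : realType} {d : nat}.
Implicit Types (P Q : Dist R d).

(** A countable base of the topology; taking interiors makes the members open by construction. *)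
Definition rat_ball (i : 'rV[rat]_d * nat) : set 'rV[R]_d :=
  (ball (map_mx ratr i.1 : 'rV[R]_d) i.2.+1%:R^-1)°.

Lemma rat_ball_base (U : set 'rV[R]_d) (x : 'rV[R]_d) : open U -> U x ->
  exists i, rat_ball i x /\ rat_ball i `<=` U.
Proof.
move=> oU Ux; have /nbhs_ballP[e /= e0 xeU] := open_nbhs_nbhs (conj oU Ux).
(* The radius [r] is below [e / 2] and the centre is within [r / 2] of [x] in each coordinate: [x]
   is interior to the ball with margin [r / 2], and no point of the ball is [e] away from [x]. *)
have [n ne] := ltr_add_invr (divr_gt0 e0 (ltr0Sn R 1)).
rewrite add0r in ne.
pose r : R := n.+1%:R^-1.
have r0 : 0 < r by rewrite invr_gt0 ltr0n.
have /choice [c cP] (j : 'I_d) : exists c : rat, `|x ord0 j - ratr c| < r / 2.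
  have : x ord0 j - r / 2 < x ord0 j + r / 2.
    by rewrite ltrD2l gtrN// divr_gt0.
  move=> /rat_in_itvoo[c]; rewrite in_itv/= => xc.
  by exists c; rewrite distrC ltr_distl.
pose i : 'rV[rat]_d * nat := (\row_j c j, n).
exists i; split.
  apply/nbhs_ballP; exists (r / 2) => /=; first by rewrite divr_gt0.
  move=> y [_ xy]; split=> // a j; rewrite !mxE -ball_normE /=.
  rewrite (le_lt_trans (ler_distD (x a j) _ _))//= -/r [ltRHS]splitr ltrD//.
    by rewrite ord1 distrC.
  by have := xy a j; rewrite -ball_normE.
move=> y /interior_subset[_ cy]; apply: xeU; split=> // a j.
have := cy a j; rewrite !mxE -!ball_normE /= -/r => {}cy.
rewrite (le_lt_trans (ler_distD (ratr (c j)) _ _))//= [ltRHS]splitr ltrD//.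
  rewrite ord1 (lt_trans (cP j))// (lt_trans _ ne)// ltr_pdivrMr//.
  by rewrite ltr_pMr// ltr1n.
exact: lt_trans cy ne.
Qed.

(** A point outside the support has an open null neighbourhood, which contains a null member of the
    countable base around the point. Measurability of the support and nullity of its complement both
    follow from this countable union. *)
Lemma suppX_setC P : ~` suppX P =
  \bigcup_(i in [set i | margX P (rat_ball i) = 0%E]) rat_ball i.
Proof.
apply/seteqP; split=> [x|x [i /= i0 ix] /(_ _ (open_interior _) ix)]; last first.
  by rewrite i0 ltxx.
move=> /existsNP[U /not_implyP[oU /not_implyP[Ux /negP]]].
rewrite -leNgt measure_le0 => /eqP U0.
have [i [ix iU]] := rat_ball_base oU Ux; exists i => //=.
have mO (V : set 'rV[R]_d) : open V -> measurable (V : set (Cov R d)).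
  by move=> oV; exact: sub_sigma_algebra.
apply/eqP; rewrite -measure_le0 -U0; apply: le_measure; rewrite ?inE.
- by apply: measurableX => //; apply: mO; exact: open_interior.
- by apply: measurableX => //; exact: mO.
- by move=> z [iz _]; split=> //; exact: iU.
Qed.

Lemma measurable_rat_ball i : measurable (rat_ball i : set (Cov R d)).
Proof. by apply: sub_sigma_algebra; exact: open_interior. Qed.

Lemma measurable_suppX P : measurable (suppX P).
Proof.
rewrite -[suppX P]setCK; apply: measurableC; rewrite suppX_setC.
by apply: countable_bigcup_measurable; exact: measurable_rat_ball.
Qed.

Lemma suppX_setC_null P : margX P (~` suppX P) = 0%E.
Proof.
rewrite suppX_setC /margX.
rewrite (_ : _ `*` setT = \bigcup_(i in [set i | margX P (rat_ball i) = 0%E])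
    (rat_ball i `*` setT)).
  apply: countable_bigcup_null => // i; apply: measurableX => //.
  exact: measurable_rat_ball.
apply/seteqP; split=> [z [[i i0 iz] _]|z [i i0 [iz _]]]; first by exists i.
by split=> //; exists i.
Qed.

End Support.

(** * Equivalence of identifiability and the condition *)

Theorem theorem1p1 (R : realType) (d : nat)
  (Pc : set (CovOut R d -> R)) (Dc : set (Dist R d)) :
  propensity_class Pc -> outcome_class Dc ->
  ATE_identifiable Pc Dc <-> identifiability_condition Pc Dc.
Proof.
move=> PcE DcE.
have p_ge0 p : Pc p -> forall z, 0 <= p z.
  by move=> /PcE p01 z; have /andP[] := p01 z.
have intY P : Dc P -> P.-integrable setT (fun z : CovOut R d => (z.2)%:E).
  by move=> /DcE[].
have Dc_ATE D p0 p1 P0 P1 : Dc P0 -> Dc P1 -> study_has D p0 p1 P0 P1 ->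
    ATE D = (meanY P1 - meanY P0)%E.
  by move=> D0 D1 [_ _ l0 l1]; apply: ATE_law => //; exact: intY.
have fin P : Dc P -> meanY P \is a fin_num.
  by move=> DP; apply: meanY_fin_num; exact: intY.
split=> [[f fE] p q P Q|cond].
  move=> [Pp [DP [ph [Ph [Dp [Pph [DPh hasp]]]]]]].
  move=> [Pq [DQ [qh [Qh [Dq [Pqh [DQh hasq]]]]]]].
  have {hasp} [D1 has1] : exists D1, study_has D1 p ph P Ph.
    by case: hasp => [?|/study_has_swap]; [exists Dp|apply; exact: p_ge0].
  have {hasq} [D2 has2] : exists D2, study_has D2 q qh Q Qh.
    by case: hasq => [?|/study_has_swap]; [exists Dq|apply; exact: p_ge0].
  have [?|mean_neq] := pselect (meanY P = meanY Q); first by constructor 1.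
  have [?|marg] := pselect (exists B : set (Cov R d),
    measurable B /\ margX P B <> margX Q B); first by constructor 2.
  constructor 3; apply: contrapT => noA.
  have margPQ B : measurable B -> margX P B = margX Q B.
    by move=> mB; apply: contrapT => ?; apply: marg; exists B.
  have [[mp _] [mq _]] : is_propensity D1 false p /\ is_propensity D2 false q.
    by case: has1 => ? _ _ _; case: has2 => ? _ _ _.
  have mS : measurable (suppX P) := measurable_suppX P.
  have mN : measurable (~` suppX P `*` @setT R).
    by apply: measurableX => //; exact: measurableC.
  have PN : P (~` suppX P `*` setT) = 0%E := suppX_setC_null P.
  have QN : Q (~` suppX P `*` setT) = 0%E.
    by rewrite -PN; apply/esym/margPQ/measurableC.
  (* Alternative (3) only tests sets above [suppX P]. The strip over its complement is null for [P],
     and for [Q] by equality of marginals, so removing it from [A] changes neither integral. *)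
  have pq A : measurable A ->
      (\int[P]_(z in A) (p z)%:E = \int[Q]_(z in A) (q z)%:E)%E.
    move=> mA.
    rewrite (ge0_negligible_integral mN)//=; last 2 first.
    - by apply: measurable_funTS; exact/measurable_EFinP.
    - by move=> z _; rewrite lee_fin p_ge0.
    rewrite [RHS](ge0_negligible_integral mN)//=; last 2 first.
    - by apply: measurable_funTS; exact/measurable_EFinP.
    - by move=> z _; rewrite lee_fin p_ge0.
    apply: contrapT => pq; apply: noA; eexists; split; [|idtac|exact: pq].
      exact: measurableD.
    by move=> z [_ nz]; split=> //; apply: contrapT => nS; exact: nz.
  have [D' has' cens'] := study_splice (p_ge0 _ Pp) (p_ge0 _ Pq) (p_ge0 _ Pph)
    has1 has2 margPQ pq.
  have real1 : realizable Pc Dc D1 by exists p, ph, P, Ph.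
  have real' : realizable Pc Dc D' by exists q, ph, Q, Ph.
  (* Equal censored laws force equal effects; the mean of [Ph] is finite and cancels, contradicting
     [mean_neq]. *)
  have := fE _ real'; rewrite cens' (fE _ real1).
  rewrite (Dc_ATE _ _ _ _ _ DP DPh has1) (Dc_ATE _ _ _ _ _ DQ DPh has').
  move: mean_neq; rewrite -(fineK (fin _ DP)) -(fineK (fin _ DQ)).
  rewrite -(fineK (fin _ DPh)) -!EFinB => neq [] /addrI /oppr_inj PQ.
  by apply: neq; rewrite PQ.
(* The marginal of X and the measure of arm [t] are determined by the censored law, so alternatives
   (2) and (3) are refuted and only equality of means remains. *)
have mean_eq D D' t p q P Q : compatible Pc Dc p P -> compatible Pc Dc q Q ->
    is_propensity D t p -> is_propensity D' t q ->
    law_is D t P -> law_is D' t Q ->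
    censored D = censored D' -> meanY P = meanY Q.
  move=> cP cQ prp prq lawP lawQ eqC.
  have [//|[B [mB]]|[A [mA _]]] := cond _ _ _ _ cP cQ.
    rewrite (margX_law lawP mB) (margX_law lawQ mB) => neq; exfalso; apply: neq.
    exact: censored_eq_covX.
  have [_ pE] := (is_propensityE lawP (p_ge0 _ cP.1)).1 prp.
  have [_ qE] := (is_propensityE lawQ (p_ge0 _ cQ.1)).1 prq.
  by rewrite -pE// -qE// => neq; exfalso; apply: neq; exact: censored_eq_arm.
have ATE_eq D D' : realizable Pc Dc D -> realizable Pc Dc D' ->
    censored D = censored D' -> ATE D = ATE D'.
  move=> [p0 [p1 [P0 [P1 [Pp0 Pp1 DP0 DP1 hasp]]]]].
  move=> [q0 [q1 [Q0 [Q1 [Pq0 Pq1 DQ0 DQ1 hasq]]]]] eqC.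
  rewrite (Dc_ATE _ _ _ _ _ DP0 DP1 hasp) (Dc_ATE _ _ _ _ _ DQ0 DQ1 hasq).
  have [prp0 prp1 lp0 lp1] := hasp; have [prq0 prq1 lq0 lq1] := hasq.
  congr (_ - _)%E.
    apply: (mean_eq D D' true p1 q1) => //.
      by split=> //; split=> //; exists p0, P0, D; do 2 split=> //; right.
    by split=> //; split=> //; exists q0, Q0, D'; do 2 split=> //; right.
  apply: (mean_eq D D' false p0 q0) => //.
    by split=> //; split=> //; exists p1, P1, D; do 2 split=> //; left.
  by split=> //; split=> //; exists q1, Q1, D'; do 2 split=> //; left.
have ATE_fin D : realizable Pc Dc D -> ATE D \is a fin_num.
  move=> [p0 [p1 [P0 [P1 [_ _ DP0 DP1 hasp]]]]].
  by rewrite (Dc_ATE _ _ _ _ _ DP0 DP1 hasp) fin_numB !fin.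
(* At the censored law of a realizable study, the value is the effect of any such study, all of them
   agreeing by [ATE_eq]; elsewhere the value 0 is arbitrary. *)
have /choice [f fP] (C : set (Cens R d) -> \bar R) : exists r : R,
    forall D, realizable Pc Dc D -> censored D = C -> r%:E = ATE D.
  have [[D0 [real0 <-]]|nD] :=
      pselect (exists D0, realizable Pc Dc D0 /\ censored D0 = C).
    exists (fine (ATE D0)) => D realD eqC; rewrite fineK ?ATE_fin//.
    exact: ATE_eq.
  by exists 0 => D realD eqC; exfalso; apply: nD; exists D.
by exists f => D realD; exact: fP.
Qed.
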